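(* Fix an integer $d\ge 2$ and $\varepsilon>0$. There is a constant $C_{d,\varepsilon}>0$ (depending only on $d$ and $\varepsilon$) such that for every integer partition $\lambda=(\lambda_1,\ldots,\lambda_d)$ of $n$ with exactly $d$ parts and $\lambda_d\ge\varepsilon n$, we have $$\delta(P_\lambda)\le\frac{C_{d,\varepsilon}}{\sqrt n}.$$
   Context: For a finite poset $P=(X,\prec)$, a linear extension is an order-preserving bijection $L:X\to\{1,\ldots,|X|\}$. For distinct $x,y\in X$ let $\delta(P;x,y)=\bigl|\mathbf{P}[L(x)<L(y)]-\mathbf{P}[L(y)<L(x)]\bigr|$ with $L$ a uniformly random linear extension, and $\delta(P)=\min_{x\ne y}\delta(P;x,y)$. For a partition $\lambda$, $P_\lambda$ is the poset on the cells $(i,j)$, $1\le i\le \ell(\lambda)$, $1\le j\le\lambda_i$, of its Young diagram with $(i,j)\preceq(i',j')$ iff $i\le i'$ and $j\le j'$. *)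

(* Defs.v *)
From HB Require Import structures.
From mathcomp Require Import all_boot all_order all_algebra reals.

Set Implicit Arguments.
Unset Strict Implicit.
Unset Printing Implicit Defensive.

Import Order.TTheory GRing.Theory Num.Theory.
Local Open Scope ring_scope.

Section LinearExtensions.
Context {disp : Order.disp_t} (T : finPOrderType disp).

(* The labels {1, ..., |T|} are shifted to 'I_#|T| = {0, ..., |T| - 1};
   injectivity is bijectivity by cardinality (lin_extP). *)
Definition lin_ext : {set {ffun T -> 'I_#|T|}} :=
  [set L : {ffun T -> 'I_#|T|} |
    injectiveb L && [forall x, forall y, (x < y)%O ==> (L x < L y)%N]].

Lemma lin_extP (L : {ffun T -> 'I_#|T|}) :
  reflect (bijective L /\ forall x y, (x < y)%O -> (L x < L y)%N)
          (L \in lin_ext).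
Proof.
rewrite inE; apply: (iffP andP) => [[/injectiveP Li /forallP Lm]|[Lb Lm]].
  split; first by apply: inj_card_bij Li _; rewrite card_ord.
  by move=> x y xy; have /forallP/(_ y)/implyP := Lm x; apply.
split; first exact/injectiveP/bij_inj.
by apply/forallP => x; apply/forallP => y; apply/implyP/Lm.
Qed.

Variable R : realType.

Definition pr_lt (x y : T) : R :=
  #|[set L in lin_ext | (L x < L y)%N]|%:R / #|lin_ext|%:R.

Definition delta_pair (x y : T) : R := `|pr_lt x y - pr_lt y x|.

(* Every delta_pair is at most 1, so the default value 1 only matters when T
   has at most one element (see delta_min). *)
Definition delta : R :=
  \big[Num.min/1]_(p : T * T | p.1 != p.2) delta_pair p.1 p.2.

Lemma pr_lt_itv x y : 0 <= pr_lt x y <= 1.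
Proof.
rewrite /pr_lt divr_ge0 //=.
have [->|n0] := eqVneq #|lin_ext| 0%N; first by rewrite invr0 mulr0 ler01.
rewrite ler_pdivrMr ?ltr0n ?lt0n // mul1r ler_nat subset_leq_card //.
by apply/subsetP => L; rewrite inE => /andP[].
Qed.

Lemma delta_pair_le1 x y : delta_pair x y <= 1.
Proof.
have /andP[a0 a1] := pr_lt_itv x y; have /andP[b0 b1] := pr_lt_itv y x.
rewrite ler_norml lerNl opprB.
by rewrite -[1]subr0 !lerB.
Qed.

Lemma delta_min (x0 y0 : T) : x0 != y0 ->
  (exists x y, x != y /\ delta = delta_pair x y) /\
  (forall x y, x != y -> delta <= delta_pair x y).
Proof.
move=> xy0; split=> [|x y xy]; last exact: (@bigmin_le_cond _ _ _ _ (x, y)).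
rewrite /delta (@bigmin_eq_arg _ _ _ _ (x0, y0)) //; last first.
  by move=> p _; exact: delta_pair_le1.
by case: arg_minP => // -[x y] /= xy _; exists x, y.
Qed.

End LinearExtensions.

Definition is_partition (n : nat) (lam : seq nat) : bool :=
  [&& sorted geq lam, all (leq 1) lam & sumn lam == n].

(* Cells of the Young diagram, with rows and columns numbered from 0. A named
   type, because sigma types already carry a lexicographic order. *)
Definition young (lam : seq nat) : Type :=
  {i : 'I_(size lam) & 'I_(nth 0%N lam i)}.

Section YoungPoset.
Variable lam : seq nat.

HB.instance Definition _ := Finite.copy (young lam)
  {i : 'I_(size lam) & 'I_(nth 0%N lam i)}.

Definition young_row (c : young lam) : nat := tag c.
Definition young_col (c : young lam) : nat := tagged c.

Definition young_le (c c' : young lam) : bool :=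
  (young_row c <= young_row c')%N && (young_col c <= young_col c')%N.

Lemma young_le_refl : reflexive young_le.
Proof. by move=> c; rewrite /young_le !leqnn. Qed.

Lemma young_le_anti : antisymmetric young_le.
Proof.
move=> [i j] [i' j']; rewrite /young_le /young_row /young_col /=.
move=> /andP[/andP[ii' jj'] /andP[i'i j'j]].
have eq_i : i = i' by apply/val_inj/anti_leq; rewrite ii'.
case: _ / eq_i j' jj' j'j {ii' i'i} => j' jj' j'j.
by congr existT; apply/val_inj/anti_leq; rewrite jj'.
Qed.

Lemma young_le_trans : transitive young_le.
Proof.
move=> c2 c1 c3 /andP[r12 s12] /andP[r23 s23].
by rewrite /young_le (leq_trans r12 r23) (leq_trans s12 s23).
Qed.

Fact young_display : Order.disp_t. Proof. exact: Order.Disp tt tt. Qed.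

HB.instance Definition _ := Order.Le_isPOrder.Build young_display (young lam)
  young_le_refl young_le_anti young_le_trans.

End YoungPoset.

(* Main.v *)
(* The entries of a standard tableau of shape lambda are read off as the word of
   their rows. Only the first and the last row matter: call their letters stars,
   let k be half the number of stars, cut the word just after the first k stars,
   and let h be the number of last-row letters before the cut. If a + b + 1 = k,
   the cell in column a of the first row precedes the cell in column b of the
   last row if and only if h <= b. Taking b + 1 to be a median of h therefore
   bounds delta by twice the probability of the atom h = b + 1.

   Exchanging a last-row letter before the cut with a first-row letter after it
   preserves the ballot condition. Counting such exchanges shows that
   P[h = j] >= (1 - O(1/sqrt n)) P[h = j + 1] as long as j is at least
   lambda_d / 2 - O(sqrt n), so an atom there has mass O(1/sqrt n).

   That the median is at least lambda_d / 2 - O(sqrt n) follows from Chebyshev's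
   inequality: the shape mu of the entries up to m = n/2 satisfies
   E sum_i (mu_i - lambda_i / 2)^2 = O(n). By the hook length formula, removing
   the largest entry of a tableau of shape c with N cells shortens row i with
   probability l_i w_i / N, where l_i = c_i + d - i and
   w_i = prod_(j <> i) (1 - 1 / (l_i - l_j)). Partial fractions give the power
   sums of the l_i weighted by the w_i, whence sum_i ((m/N) l_i - g_i)^2 is a
   supermartingale up to a bounded drift, for every nonincreasing g >= 0; the
   choice of g that makes it start at 0 yields the second moment. *)
Require Import Defs.
From mathcomp Require Import all_boot all_order all_algebra reals.
From mathcomp Require Import zify ring lra.
Import Order.TTheory GRing.Theory Num.Theory.
Local Open Scope ring_scope.

Set Implicit Arguments.
Unset Strict Implicit.
Unset Printing Implicit Defensive.

(** * Uniform averages over a list *)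

Section Mean.
Variables (R : realFieldType) (T : eqType) (s : seq T).
Implicit Types (f : T -> R) (P : pred T) (X : T -> nat).

Definition mean f : R := (\sum_(x <- s) f x) / (size s)%:R.

Definition prob P : R := mean (fun x => (P x)%:R).

Definition cdf X z : R := prob (fun x => X x <= z)%N.

Definition atom X j : R := prob (fun x => X x == j).

Lemma ler_mean f g : {in s, forall x, f x <= g x} -> mean f <= mean g.
Proof.
move=> fg; rewrite /mean ler_wpM2r ?invr_ge0 //.
by rewrite big_seq [leRHS]big_seq ler_sum.
Qed.

Lemma eq_mean f g : {in s, f =1 g} -> mean f = mean g.
Proof. by move=> fg; rewrite /mean (eq_big_seq g fg). Qed.

Lemma mean_ge0 f : {in s, forall x, 0 <= f x} -> 0 <= mean f.
Proof. by move=> f0; rewrite divr_ge0 // big_seq sumr_ge0. Qed.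

Lemma mean_cst (a : R) : (0 < size s)%N -> mean (fun=> a) = a.
Proof.
move=> s0; rewrite /mean big_const_seq count_predT iter_addr_0.
by rewrite -[a *+ _]mulr_natr mulfK // pnatr_eq0 -lt0n.
Qed.

Lemma meanD f g : mean (fun x => f x + g x) = mean f + mean g.
Proof. by rewrite /mean big_split mulrDl. Qed.

Lemma meanZ a f : mean (fun x => a * f x) = a * mean f.
Proof. by rewrite /mean -mulr_sumr mulrA. Qed.

Lemma probE P : prob P = (count P s)%:R / (size s)%:R.
Proof.
rewrite /prob /mean -sum1_count natr_sum [in RHS]big_mkcond; congr (_ / _).
by apply: eq_bigr => x _; case: (P x).
Qed.

Lemma prob_ge0 P : 0 <= prob P.
Proof. exact: mean_ge0. Qed.

Lemma prob_le1 P : prob P <= 1.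
Proof.
rewrite probE.
have [->|s0] := eqVneq (size s) 0%N; first by rewrite invr0 mulr0.
by rewrite ler_pdivrMr ?ltr0n ?lt0n // mul1r ler_nat count_size.
Qed.

Lemma markov_inequality f P a : {in s, forall x, 0 <= f x} ->
  {in s, forall x, P x -> a <= f x} -> a * prob P <= mean f.
Proof.
move=> f0 af; rewrite -meanZ; apply: ler_mean => x xs.
by case: (boolP (P x)) => [/(af _ xs)|_]; rewrite ?mulr1 // mulr0 f0.
Qed.

Lemma cdf_sum X z : cdf X z = \sum_(j < z.+1) atom X j.
Proof.
elim: z => [|z IHz]; rewrite big_ord_recr /=.
  by rewrite big_ord0 add0r; apply: eq_mean => x _; rewrite leqn0.
rewrite -{}IHz -meanD; apply: eq_mean => x _.
by rewrite leq_eqVlt ltnS; case: eqP => [->|_]; rewrite ?ltnn ?add0r ?addr0.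
Qed.

Definition lower_median X b :=
  1 / 2 <= cdf X b /\ forall z, (z < b)%N -> cdf X z < 1 / 2.

Lemma lower_median_exists X : (0 < size s)%N ->
  exists2 x, x \in s & lower_median X (X x).
Proof.
move=> s0; pose half z := 1 / 2 <= cdf X z.
have half_max : half (\max_(x <- s) X x).
  rewrite /half /cdf probE (eqP (_ : count _ s == size s)).
    by rewrite divff ?pnatr_eq0 -?lt0n //; lra.
  by rewrite -all_count; apply/allP => x xs; exact: leq_bigmax_seq.
case: (ex_minnP (ex_intro half _ half_max)) => b half_b b_min.
have below z : (z < b)%N -> cdf X z < 1 / 2.
  by move=> zb; rewrite ltNge; apply: contraL zb => /b_min; rewrite -leqNgt.
have [/hasP[x xs /eqP Xx]|/hasPn no_b] := boolP (has (fun x => X x == b) s).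
  by exists x => //; rewrite Xx; split.
have atom0 : atom X b = 0.
  rewrite /atom probE (eqP (_ : count _ s == 0%N)) ?mul0r //.
  by rewrite -leqn0 leqNgt -has_count -all_predC; apply/allP.
move: half_b; rewrite /half cdf_sum big_ord_recr /= {}atom0 addr0.
case: b below {b_min no_b} => [|b] below; first by rewrite big_ord0; lra.
by rewrite -cdf_sum; have := below b (ltnSn b); lra.
Qed.

Lemma lower_median_jump X b : lower_median X b.+1 ->
  `|2 * cdf X b - 1| <= 2 * atom X b.+1.
Proof.
case=> + /(_ b (ltnSn b)); rewrite cdf_sum big_ord_recr /= -cdf_sum.
by move=> ge_half lt_half; rewrite ler0_norm; lra.
Qed.

End Mean.

Lemma slow_decay_le (R : realFieldType) (u : nat -> R) (b S : nat) (t : R) :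
  (forall j, 0 <= u j) -> \sum_(j < b.+1) u j <= 1 -> (S <= b)%N ->
  0 <= t -> S%:R * t <= 1 / 2 ->
  (forall j, (b - S <= j < b)%N -> (1 - t) * u j.+1 <= u j) ->
  S.+1%:R / 2 * u b <= 1.
Proof.
move=> u0 u_sum Sb t0 St decay.
have atom_ge i : (i <= S)%N -> (1 - i%:R * t) * u b <= u (b - i)%N.
  elim: i => [|i IHi] iS; first by rewrite mul0r subr0 mul1r subn0.
  have bi : (b - i)%N = (b - i.+1).+1 by lia.
  apply: le_trans (decay _ _); last by lia.
  rewrite -bi; have t1 : 0 <= 1 - t.
    have S1 : 1 <= S%:R :> R by rewrite ler1n (leq_trans _ iS).
    by have := ler_wpM2r t0 S1; lra.
  apply: le_trans (ler_wpM2l t1 (IHi (ltnW iS))); rewrite mulrA.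
  apply: ler_wpM2r => //; rewrite -natr1.
  have : 0 <= i%:R * t * t by rewrite !mulr_ge0.
  by lra.
apply: le_trans u_sum; rewrite (reindex_inj rev_ord_inj) /=.
rewrite (bigID (fun i : 'I_b.+1 => i < S.+1)%N) /= -[leLHS]addr0.
apply: lerD; last exact: sumr_ge0.
rewrite (big_ord_narrow (Sb : (S.+1 <= b.+1)%N)) /=.
have -> : S.+1%:R / 2 * u b = \sum_(i < S.+1) (1 / 2 * u b).
  by rewrite sumr_const card_ord -[RHS]mulr_natl; ring.
apply: ler_sum => i _; have iS : (i <= S)%N by rewrite -ltnS.
rewrite subSS; apply: le_trans (atom_ge i iS); apply: ler_wpM2r => //.
have : i%:R * t <= S%:R * t by rewrite ler_wpM2r // ler_nat.
by lra.
Qed.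

(** * Partial fraction weights *)

Section Weights.
Variable R : realFieldType.
Implicit Types (d : nat) (x g : nat -> R) (y : R).

(* The factor [j = i] equals [1], because [0^-1 = 0]. *)
Definition weight d x (i : nat) : R := \prod_(j < d) (1 - (x i - x j)^-1).

Lemma weightS d x i : weight d.+1 x i = weight d x i * (1 - (x i - x d)^-1).
Proof. by rewrite /weight big_ord_recr. Qed.

Lemma weightS_last d x : weight d.+1 x d = weight d x d.
Proof. by rewrite weightS subrr invr0 subr0 mulr1. Qed.

Definition gapped d x := forall i j, (i < j < d)%N -> x j + 1 <= x i.

Lemma gappedS d x : gapped d.+1 x -> gapped d x.
Proof. by move=> gx i j /andP[ij jd]; apply: gx; rewrite ij ltnW. Qed.

Lemma gapped_last d x i : gapped d.+1 x -> (i < d)%N -> 0 < x i - x d.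
Proof. by move=> gx id; have := gx i d; rewrite id ltnSn => /(_ isT); lra. Qed.

Lemma gapped_last_neq d x i : gapped d.+1 x -> (i < d)%N -> x d != x i.
Proof. by move=> gx /(gapped_last gx); rewrite eq_sym -subr_eq0; lra. Qed.

Lemma weight_ge0 d x i : gapped d x -> (i < d)%N -> 0 <= weight d x i.
Proof.
move=> gx id; apply: prodr_ge0 => j _.
have [ij|ji|->] := ltngtP i j; last by rewrite subrr invr0 subr0.
- have := gx i j; rewrite ij ltn_ord => /(_ isT) gap.
  by rewrite subr_ge0 invf_le1; lra.
- have := gx j i; rewrite ji id => /(_ isT) gap.
  have : (x i - x j)^-1 <= 0 by rewrite invr_le0; lra.
  by lra.
Qed.

Lemma prod_partial_fractions d x y : gapped d x ->
  (forall i, (i < d)%N -> y != x i) ->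
  \prod_(j < d) (1 - (y - x j)^-1) = 1 - \sum_(i < d) weight d x i / (y - x i).
Proof.
elim: d y => [|d IHd] y gx yx; first by rewrite !big_ord0 subr0.
have gx' := gappedS gx.
rewrite !big_ord_recr /= weightS_last.
rewrite IHd //; last by move=> i id; exact/yx/ltnW.
rewrite [weight d x d]IHd //; last by move=> i; exact: gapped_last_neq.
set s := \sum_(i < d) _ / _; set t := \sum_(i < d) _ / (x d - x _).
suff -> : \sum_(i < d) weight d.+1 x i / (y - x i) =
    s + (t - s) / (y - x d) by ring.
rewrite mulrBl !mulr_suml -sumrB -big_split; apply: eq_bigr => i _ /=.
have := gapped_last_neq gx (ltn_ord i); have := yx _ (ltnW (ltn_ord i)).
have := yx d (ltnSn d); rewrite weightS -![_ == x _]subr_eq0 => yd yi di.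
by field; rewrite yi yd di -oppr_eq0 opprB di.
Qed.

Lemma sum_weight_recr d x g : gapped d.+1 x ->
  \sum_(i < d.+1) g i * weight d.+1 x i = \sum_(i < d) g i * weight d x i + g d
    - \sum_(i < d) weight d x i * ((g i - g d) / (x i - x d)).
Proof.
move=> gx; rewrite big_ord_recr /= weightS_last.
rewrite [weight d x d]prod_partial_fractions;
  [|exact: gappedS|by move=> i; exact: gapped_last_neq].
suff -> : \sum_(i < d) g i * weight d.+1 x i = \sum_(i < d) g i * weight d x i
    + g d * (\sum_(i < d) weight d x i / (x d - x i))
    - \sum_(i < d) weight d x i * ((g i - g d) / (x i - x d)) by ring.
rewrite mulr_sumr -big_split -sumrB; apply: eq_bigr => i _ /=.
have := gapped_last gx (ltn_ord i); rewrite weightS => gap.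
have gap' : x d - x i != 0 by lra.
by field; rewrite gap' /=; lra.
Qed.

Lemma sum_weight d x : gapped d x -> \sum_(i < d) weight d x i = d%:R.
Proof.
elim: d => [|d IHd] gx; first by rewrite big_ord0.
have := sum_weight_recr (fun=> 1) gx; under eq_bigr do rewrite mul1r.
under [X in _ = X + _ - _]eq_bigr do rewrite mul1r.
move=> ->; rewrite IHd; last exact: gappedS.
by rewrite big1 ?subr0 ?natr1 // => i _; rewrite subrr mul0r mulr0.
Qed.

Lemma sum_mul_weight d x : gapped d x ->
  \sum_(i < d) x i * weight d x i = \sum_(i < d) x i - 'C(d, 2)%:R.
Proof.
elim: d => [|d IHd] gx; first by rewrite !big_ord0 subr0.
have gx' := gappedS gx.
rewrite sum_weight_recr // IHd //.
rewrite [X in _ + _ - X](eq_bigr (fun i : 'I_d => weight d x i)) => [|i _].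
  by rewrite sum_weight // big_ord_recr binS bin1 natrD /=; ring.
by rewrite divff ?mulr1 // gt_eqF // gapped_last.
Qed.

Lemma sum_sqr_weight_ge d x : gapped d x -> (forall i, 0 <= x i) ->
  \sum_(i < d) x i ^+ 2 - d%:R * \sum_(i < d) x i
  <= \sum_(i < d) x i ^+ 2 * weight d x i.
Proof.
move=> + x0; elim: d => [|d IHd] gx; first by rewrite !big_ord0 mulr0 subr0.
have gx' := gappedS gx; rewrite (sum_weight_recr (fun i => x i ^+ 2)) //.
rewrite [X in _ + _ - X](eq_bigr (fun i : 'I_d =>
  x i * weight d x i + x d * weight d x i)) => [|i _].
  rewrite big_split /= -mulr_sumr sum_mul_weight // sum_weight //.
  rewrite !big_ord_recr /= -natr1.
  by have := IHd gx'; have := ler0n R 'C(d, 2); have := x0 d; lra.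
by have := gapped_last gx (ltn_ord i) => gap; field; lra.
Qed.

Lemma sum_nonincreasing_weight_le d x g : gapped d x -> (forall i, 0 <= x i) ->
  (forall i, 0 <= g i) -> (forall i j, (i <= j)%N -> g j <= g i) ->
  \sum_(i < d) g i * x i * weight d x i <= \sum_(i < d) g i * x i.
Proof.
move=> + x0 g0 gd; elim: d => [|d IHd] gx; first by rewrite !big_ord0.
have gx' := gappedS gx.
rewrite (sum_weight_recr (fun i => g i * x i)) // big_ord_recr /= lerBlDr.
apply: le_trans (lerD (IHd gx') (lexx _)) _; rewrite lerDl.
apply: sumr_ge0 => i _; apply: mulr_ge0; first exact: weight_ge0.
have gap := gapped_last gx (ltn_ord i).
apply: divr_ge0; last exact: ltW.
by rewrite subr_ge0 ler_pM // ?gd ?(ltnW (ltn_ord i)) // -subr_ge0 ltW.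
Qed.

Definition vdm d x : R := \prod_(j < d) \prod_(i < j) (x i - x j).

Lemma vdmS d x : vdm d.+1 x = vdm d x * \prod_(i < d) (x i - x d).
Proof. by rewrite /vdm big_ord_recr. Qed.

Lemma vdm_gt0 d x : gapped d x -> 0 < vdm d x.
Proof.
move=> gx; apply: prodr_gt0 => j _; apply: prodr_gt0 => i _.
by have := gx i j; rewrite !ltn_ord => /(_ isT); lra.
Qed.

Lemma vdm_decr d x a : gapped d x -> (a < d)%N ->
  vdm d (fun i => x i - (i == a)%:R) = vdm d x * weight d x a.
Proof.
elim: d => [//|d IHd] gx; have gx' := gappedS gx.
rewrite ltnS leq_eqVlt !vdmS => /predU1P[->|ad].
  rewrite eqxx weightS_last -mulrA /weight -[in RHS]big_split /=; congr (_ * _).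
    apply: eq_bigr => j _; apply: eq_bigr => i _.
    by rewrite !ltn_eqF ?(ltn_trans (ltn_ord i)) ?subr0 // ltn_ord.
  apply: eq_bigr => i _; rewrite ltn_eqF ?ltn_ord // subr0.
  have gap := gapped_last gx (ltn_ord i); have gap' : x d - x i != 0 by lra.
  by field.
rewrite IHd // weightS gtn_eqF // subr0.
rewrite (bigD1 (Ordinal ad)) //= [in RHS](bigD1 (Ordinal ad)) //= eqxx.
rewrite (eq_bigr (fun i : 'I_d => x i - x d)) => [|i /negPf]; last first.
  by rewrite -val_eqE /= => ->; rewrite subr0.
by have gap := gapped_last gx ad; rewrite mulr1n; field; lra.
Qed.

End Weights.

(** * Ballot words *)

Section Words.
Local Open Scope nat_scope.
Variable d : nat.
Implicit Types (c : nat -> nat) (w : seq nat).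

(* Partitions of [n] with at most [d] parts, as eventually zero sequences. *)
Definition is_shape n c :=
  [/\ forall i, c i.+1 <= c i, c d = 0 & \sum_(i < d) c i = n].

Definition corner c (i : nat) := c i.+1 < c i.

Definition del_cell c (i : nat) : nat -> nat := fun j => c j - (j == i).

Definition content w (x : nat) := count_mem x w.

Definition ballot w :=
  forall t x, content (take t w) x.+1 <= content (take t w) x.

(* A standard tableau is encoded by the word whose t-th letter is the row of
   the entry t; the rows are numbered from 0 and row [i] has length [c i]. *)
Fixpoint words n c : seq (seq nat) :=
  if n is m.+1 then
    [seq rcons w i | i <- [seq i <- index_iota 0 d | corner c i],
                     w <- words m (del_cell c i)]
  else [:: [::]].

Lemma shape_nonincreasing n c i j : is_shape n c -> i <= j -> c j <= c i.
Proof.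
case=> cS _ _; elim: j => [|j IHj]; first by rewrite leqn0 => /eqP->.
by rewrite leq_eqVlt => /predU1P[->//|ij]; apply: leq_trans (cS j) (IHj ij).
Qed.

Lemma shape_eq0 n c i : is_shape n c -> d <= i -> c i = 0.
Proof.
move=> sc /(shape_nonincreasing sc); case: sc => _ -> _.
by rewrite leqn0 => /eqP.
Qed.

Lemma shape0_eq0 c : is_shape 0 c -> c =1 fun=> 0.
Proof.
move=> sc i; have [id|di] := ltnP i d; last exact: shape_eq0 sc di.
case: sc => _ _ /eqP; rewrite sum_nat_eq0 => /forallP/(_ (Ordinal id)).
by move/eqP.
Qed.

Lemma leq_shape n c i : is_shape n c -> i < d -> c i <= n.
Proof. by case=> _ _ <- id; rewrite (bigD1 (Ordinal id)) //= leq_addr. Qed.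

Lemma corner_lt n c i : is_shape n c -> corner c i -> i < d.
Proof.
by move=> sc; have [//|di] := ltnP i d; rewrite /corner (shape_eq0 sc di).
Qed.

Lemma corner_gt0 c i : corner c i -> 0 < c i.
Proof. by rewrite /corner; case: (c i). Qed.

Lemma del_cell_shape n c i :
  is_shape n.+1 c -> corner c i -> is_shape n (del_cell c i).
Proof.
move=> sc ci; have id := corner_lt sc ci; case: (sc) => cS cd cn.
split=> [j||]; rewrite /del_cell ?cd ?sub0n //.
  move: ci (cS j); rewrite /corner.
  by have [->|_] := eqVneq j i; rewrite ?subn0; lia.
move: cn; rewrite (bigD1 (Ordinal id)) //=.
rewrite [in X in _ -> X](bigD1 (Ordinal id)) //=.
rewrite eqxx [X in _ -> _ + X = _](eq_bigr (fun j : 'I_d => c j)) => [|j].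
  by have := corner_gt0 ci; lia.
by rewrite -val_eqE /= => /negPf ->; rewrite subn0.
Qed.

Lemma content_take_drop t w x :
  content (take t w) x + content (drop t w) x = content w x.
Proof. by rewrite -count_cat cat_take_drop. Qed.

Lemma content_rcons w i x : content (rcons w i) x = content w x + (i == x).
Proof. by rewrite /content -cats1 count_cat /= addn0. Qed.

Lemma ballot_rcons w i : ballot (rcons w i) <->
  ballot w /\ forall x, content (rcons w i) x.+1 <= content (rcons w i) x.
Proof.
split=> [bw|[bw bwi] t x]; first split=> [t x|x].
- have [tw|/ltnW wt] := leqP t (size w).
    by have := bw t x; rewrite -cats1 takel_cat.
  have := bw (size w) x; rewrite -cats1 takel_cat // take_size.
  by rewrite take_oversize.
- by have := bw (size w).+1 x; rewrite take_oversize ?size_rcons.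
have [tw|wt] := leqP t (size w); first by rewrite -cats1 takel_cat.
by rewrite take_oversize ?size_rcons.
Qed.

Lemma mem_words n c w : is_shape n c ->
  w \in words n c <-> ballot w /\ content w =1 c.
Proof.
elim: n c w => [|n IHn] c w sc.
  have c0 := shape0_eq0 sc.
  rewrite inE; split=> [/eqP->|[_]]; first by split=> // x; rewrite c0.
  by case: w => // a w /(_ a); rewrite c0 /content /= eqxx.
have [cS _ cn] := sc; split.
  case/allpairsPdep=> i [v [+ + ->]]; rewrite mem_filter => /andP[ci _].
  case/(IHn _ v (del_cell_shape sc ci))=> bv cv.
  have cvi : content (rcons v i) =1 c.
    move=> x; rewrite content_rcons cv /del_cell eq_sym subnK //.
    by case: eqVneq => // <-; exact: corner_gt0.
  by split=> //; apply/ballot_rcons; split=> // x; rewrite !cvi.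
case/lastP: w => [|v i] [bw cw].
  by move: cn; rewrite big1 // => j _; rewrite -cw.
have cv : content v =1 del_cell c i.
  by move=> x; rewrite /del_cell -cw content_rcons eq_sym addnK.
have /ballot_rcons[bv _] := bw.
have ci : corner c i.
  have := bv (size v) i; rewrite take_size /corner -!cw !content_rcons eqxx.
  by rewrite ltn_eqF // addn0 addn1 ltnS.
apply/allpairsPdep; exists i, v; split=> //.
  by rewrite mem_filter ci mem_index_iota (corner_lt sc).
by apply/(IHn _ v (del_cell_shape sc ci)).
Qed.

Lemma words_uniq n c : uniq (words n c).
Proof.
elim: n c => [//|n IHn] c /=; apply: allpairs_uniq_dep => //.
  by rewrite filter_uniq // iota_uniq.
by move=> [i v] [j w] _ _ /= /rcons_inj[-> ->].
Qed.

Lemma size_mem_words n c w : w \in words n c -> size w = n.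
Proof.
elim: n c w => [|n IHn] c w; first by rewrite inE => /eqP->.
by case/allpairsPdep=> i [v [_ /IHn vn ->]]; rewrite size_rcons vn.
Qed.

End Words.

Lemma big_words (R : zmodType) d n c (phi : seq nat -> R) :
  \sum_(w <- words d n.+1 c) phi w =
  \sum_(i < d | corner c i)
    \sum_(w <- words d n (del_cell c i)) phi (rcons w i).
Proof. by rewrite big_allpairs_dep big_filter big_mkord. Qed.

(** * The hook length formula *)

Section HookFormula.
Variables (R : realFieldType) (d : nat).
Implicit Types (c : nat -> nat).

(* The hook length of the first cell of row [i]. *)
Definition first_hook c (i : nat) : nat := (c i + (d - i.+1))%N.

Definition ell c (i : nat) : R := (first_hook c i)%:R.

Lemma ell_ge0 c i : 0 <= ell c i.
Proof. exact: ler0n. Qed.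

Lemma ell_nonincreasing n c i j : is_shape d n c -> (i <= j)%N ->
  ell c j <= ell c i.
Proof.
move=> sc ij; rewrite ler_nat leq_add ?(shape_nonincreasing sc) //.
by rewrite leq_sub2l.
Qed.

Lemma ell_gapped n c : is_shape d n c -> gapped d (ell c).
Proof.
move=> sc i j /andP[ij jd]; rewrite /ell /first_hook natr1 ler_nat.
by have := shape_nonincreasing sc (ltnW ij); lia.
Qed.

Lemma ell_del_cell c i : (0 < c i)%N ->
  ell (del_cell c i) =1 (fun j => ell c j - (j == i)%:R).
Proof.
move=> ci j; rewrite /ell /first_hook /del_cell.
case: eqVneq => [->|]; last by rewrite subn0 subr0.
by rewrite -natrB; [congr _%:R; lia|lia].
Qed.

Lemma ell_weight_eq0 n c i : is_shape d n c -> (i < d)%N -> ~~ corner c i ->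
  ell c i * weight d (ell c) i = 0.
Proof.
move=> sc id; rewrite /corner -leqNgt => ci.
have {}ci : c i.+1 = c i.
  by apply/eqP; rewrite eqn_leq ci (shape_nonincreasing sc).
have [id'|di] := ltnP i.+1 d.
  have hookS : first_hook c i = (first_hook c i.+1).+1.
    by rewrite /first_hook ci; lia.
  rewrite /weight (bigD1 (Ordinal id')) //= {2}/ell hookS -natr1 addrAC subrr.
  by rewrite add0r invr1 subrr mul0r mulr0.
have hook0 : first_hook c i = 0%N.
  by rewrite /first_hook -ci (shape_eq0 sc di); lia.
by rewrite /ell hook0 mul0r.
Qed.

Lemma sum_ell n c : is_shape d n c -> \sum_(i < d) ell c i = n%:R + 'C(d, 2)%:R.
Proof.
case=> _ _ <-; rewrite -natrD -natr_sum big_split /=; congr ((_ + _)%N%:R).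
by rewrite -bin2_sum big_mkord [RHS](reindex_inj rev_ord_inj).
Qed.

Lemma sum_ell_weight n c : is_shape d n c ->
  \sum_(i < d) ell c i * weight d (ell c) i = n%:R.
Proof.
move=> sc; rewrite sum_mul_weight ?(sum_ell sc) ?addrK //.
exact: ell_gapped sc.
Qed.

Lemma prod_fact_gt0 (f : nat -> nat) : 0 < \prod_(i < d) (f i)`!%:R :> R.
Proof. by apply: prodr_gt0 => i _; rewrite ltr0n fact_gt0. Qed.

Definition inv_hook_prod c : R :=
  vdm d (ell c) / \prod_(i < d) (first_hook c i)`!%:R.

Lemma inv_hook_prod_gt0 n c : is_shape d n c -> 0 < inv_hook_prod c.
Proof.
by move=> sc; rewrite divr_gt0 ?prod_fact_gt0 //; exact/vdm_gt0/(ell_gapped sc).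
Qed.

Lemma inv_hook_prod0 : inv_hook_prod (fun=> 0%N) = 1.
Proof.
rewrite /inv_hook_prod [X in _ / X](reindex_inj rev_ord_inj) /=.
rewrite [X in _ / X](eq_bigr (fun j : 'I_d => j`!%:R)) => [|j _]; last first.
  by rewrite /first_hook add0n subnSK // subKn // ltnW.
suff -> : vdm d (ell (fun=> 0%N)) = \prod_(j < d) j`!%:R.
  by rewrite divff // lt0r_neq0 // (prod_fact_gt0 id).
apply: eq_bigr => j _; rewrite fact_prod natr_prod big_add1 /= big_mkord.
rewrite (reindex_inj rev_ord_inj) /=; apply: eq_bigr => i _.
have := ltn_ord i; have := ltn_ord j; rewrite /ell /first_hook => jd ij.
by rewrite -natrB; [congr _%:R; lia|lia].
Qed.

Lemma inv_hook_prod_del_cell n c i : is_shape d n.+1 c -> corner c i ->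
  inv_hook_prod (del_cell c i) =
  inv_hook_prod c * (ell c i * weight d (ell c) i).
Proof.
move=> sc ci; have id := corner_lt sc ci; have ci0 := corner_gt0 ci.
have vdmE : vdm d (ell (del_cell c i)) = vdm d (ell c) * weight d (ell c) i.
  rewrite -vdm_decr //; last exact: ell_gapped sc.
  by apply: eq_bigr => j _; apply: eq_bigr => k _; rewrite !ell_del_cell.
have hookS : first_hook c i = (first_hook (del_cell c i) i).+1.
  by rewrite /first_hook /del_cell eqxx; lia.
have factE : \prod_(j < d) (first_hook c j)`!%:R =
    ell c i * \prod_(j < d) (first_hook (del_cell c i) j)`!%:R.
  rewrite (bigD1 (Ordinal id)) //= [in RHS](bigD1 (Ordinal id)) //= mulrA.
  rewrite /ell {1 2}hookS factS natrM; congr (_ * _).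
  apply: eq_bigr => j; rewrite -val_eqE /= /first_hook /del_cell => /negPf ->.
  by rewrite subn0.
have ell_neq0 : ell c i != 0 by rewrite /ell hookS pnatr_eq0.
have fact_neq0 := lt0r_neq0 (prod_fact_gt0 (first_hook (del_cell c i))).
rewrite /inv_hook_prod vdmE factE.
set P := \prod_(j < d) _ in fact_neq0 *; by field; apply/andP.
Qed.

Lemma size_words n c : is_shape d n c ->
  (size (words d n c))%:R = n`!%:R * inv_hook_prod c.
Proof.
elim: n c => [|n IHn] c sc.
  rewrite mul1r -inv_hook_prod0 /inv_hook_prod; congr (_ / _).
    apply: eq_bigr => j _; apply: eq_bigr => k _.
    by rewrite /ell /first_hook !(shape0_eq0 sc).
  by apply: eq_bigr => j _; rewrite /first_hook (shape0_eq0 sc).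
have sizeE m v : (size (words d m v))%:R = \sum_(w <- words d m v) (1 : R).
  by rewrite big_const_seq count_predT iter_addr_0.
rewrite sizeE big_words factS natrM -(sum_ell_weight sc) !mulr_suml.
rewrite [RHS](bigID (fun i : 'I_d => corner c i)) /=.
rewrite [X in _ = _ + X]big1 ?addr0.
  apply: eq_bigr => i ci; rewrite -sizeE IHn; last exact: del_cell_shape.
  by rewrite (inv_hook_prod_del_cell sc ci); ring.
by move=> i ci; rewrite (ell_weight_eq0 sc) // !mul0r.
Qed.

End HookFormula.

Lemma size_words_gt0 d n c : is_shape d n c -> (0 < size (words d n c))%N.
Proof.
move=> sc; rewrite -(ltr_nat rat) (size_words rat sc).
rewrite mulr_gt0 ?ltr0n ?fact_gt0 //.
exact: inv_hook_prod_gt0 sc.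
Qed.

(** * The second moment of an intermediate shape *)

Section SecondMoment.
Variables (R : realFieldType) (d : nat).
Implicit Types (c : nat -> nat) (w : seq nat) (g : nat -> R).

Local Notation ell := (@ell R d).

(* The probability that the largest entry of a uniform tableau of shape [c] is
   in row [i]. *)
Definition removal_prob n c i : R := ell c i * weight d (ell c) i / n%:R.

Lemma removal_probE n c i : is_shape d n.+1 c -> corner c i ->
  (size (words d n (del_cell c i)))%:R / (size (words d n.+1 c))%:R =
  removal_prob n.+1 c i.
Proof.
move=> sc ci; have sci := del_cell_shape sc ci.
rewrite !size_words // (inv_hook_prod_del_cell _ sc ci).
have hook_neq0 := lt0r_neq0 (inv_hook_prod_gt0 R sc).
have n0 : n.+1%:R != 0 :> R by rewrite pnatr_eq0.
have f0 : n`!%:R != 0 :> R by rewrite pnatr_eq0 -lt0n fact_gt0.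
by rewrite factS natrM /removal_prob; field; rewrite hook_neq0 f0 nat1r n0.
Qed.

Lemma sum_corner_removal_prob n c (f : nat -> R) : is_shape d n c ->
  \sum_(i < d | corner c i) removal_prob n c i * f i =
  \sum_(i < d) removal_prob n c i * f i.
Proof.
move=> sc; rewrite [RHS](bigID (fun i : 'I_d => corner c i)) /=.
rewrite [X in _ = _ + X]big1 ?addr0 //.
by move=> i ci; rewrite /removal_prob (ell_weight_eq0 R sc) // !mul0r.
Qed.

Lemma sum_removal_prob n c : is_shape d n.+1 c ->
  \sum_(i < d) removal_prob n.+1 c i = 1.
Proof.
by move=> sc; rewrite -mulr_suml (sum_ell_weight R sc) divff ?pnatr_eq0.
Qed.

Lemma mean_words_recr n c (phi : seq nat -> R) : is_shape d n.+1 c ->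
  mean (words d n.+1 c) phi = \sum_(i < d | corner c i)
    removal_prob n.+1 c i *
      mean (words d n (del_cell c i)) (fun w => phi (rcons w i)).
Proof.
move=> sc; rewrite /mean big_words mulr_suml; apply: eq_bigr => i ci.
have size_neq0 : (size (words d n (del_cell c i)))%:R != 0 :> R.
  by rewrite pnatr_eq0 -lt0n size_words_gt0 //; exact: del_cell_shape.
by rewrite -(removal_probE sc ci) [RHS]mulrC mulrA mulfVK.
Qed.

(* Optional stopping for the Markov chain that removes the largest entries. *)
Lemma mean_words_take_le m (phi : seq nat -> R) (B : nat -> (nat -> nat) -> R) :
  (forall c w, is_shape d m c -> w \in words d m c -> phi w <= B m c) ->
  (forall n c, (m <= n)%N -> is_shape d n.+1 c ->
     \sum_(i < d | corner c i) removal_prob n.+1 c i * B n (del_cell c i)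
     <= B n.+1 c) ->
  forall n c, (m <= n)%N -> is_shape d n c ->
  mean (words d n c) (fun w => phi (take m w)) <= B n c.
Proof.
move=> B_end B_step n c mn; rewrite -(subnK mn) addnC.
elim: (n - m)%N c => [|t IHt] c sc.
  rewrite addn0 in sc *.
  apply: (@le_trans _ _ (mean (words d m c) (fun=> B m c))).
    apply: ler_mean => w ww; rewrite take_oversize ?(size_mem_words ww) //.
    exact: B_end ww.
  by rewrite mean_cst ?size_words_gt0.
rewrite addnS in sc *; apply: le_trans (B_step _ _ (leq_addr _ _) sc).
rewrite (mean_words_recr _ sc); apply: ler_sum => i ci.
have id := corner_lt sc ci; apply: ler_wpM2l.
  by rewrite divr_ge0 // mulr_ge0 ?ell_ge0 ?weight_ge0 //; exact: ell_gapped sc.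
apply: le_trans (IHt _ (del_cell_shape sc ci)); apply: ler_mean => w ww.
by rewrite -cats1 takel_cat // (size_mem_words ww) leq_addr.
Qed.

Definition sqr_dist (a : R) c g : R := \sum_(j < d) (a * ell c j - g j) ^+ 2.

Lemma sqr_dist_del_cell a c g i : (i < d)%N -> (0 < c i)%N ->
  sqr_dist a (del_cell c i) g =
  sqr_dist a c g - 2 * a ^+ 2 * ell c i + 2 * a * g i + a ^+ 2.
Proof.
move=> id ci; rewrite /sqr_dist (bigD1 (Ordinal id)) //=.
rewrite [in RHS](bigD1 (Ordinal id)) //=.
rewrite [X in _ + X = _](eq_bigr
  (fun j : 'I_d => (a * ell c j - g j) ^+ 2)) => [|j].
  by rewrite ell_del_cell // eqxx mulr1n; ring.
by rewrite ell_del_cell // -val_eqE /= => /negPf ->; rewrite subr0.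
Qed.

Definition drift_const : R := 1 + 2 * d%:R * (1 + 'C(d, 2)%:R).

Lemma sum_removal_prob_sqr_dist n c g (a : R) : is_shape d n.+1 c ->
  \sum_(i < d) removal_prob n.+1 c i *
     (sqr_dist a c g - 2 * a ^+ 2 * ell c i + 2 * a * g i + a ^+ 2) =
  sqr_dist a c g + a ^+ 2
    - 2 * a ^+ 2 * ((\sum_(i < d) ell c i ^+ 2 * weight d (ell c) i) / n.+1%:R)
    + 2 * a * ((\sum_(i < d) g i * ell c i * weight d (ell c) i) / n.+1%:R).
Proof.
move=> sc; have -> : sqr_dist a c g + a ^+ 2 =
    (\sum_(i < d) removal_prob n.+1 c i) * (sqr_dist a c g + a ^+ 2).
  by rewrite (sum_removal_prob sc) mul1r.
rewrite !mulr_suml !mulr_sumr -sumrB -big_split; apply: eq_bigr => i _ /=.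
by rewrite /removal_prob; move: n.+1%:R => N; ring.
Qed.

Lemma sqr_dist_supermartingale n c g (a : R) : is_shape d n.+1 c ->
  0 <= a <= 1 -> (forall i, 0 <= g i) ->
  (forall i j, (i <= j)%N -> g j <= g i) ->
  \sum_(i < d) removal_prob n.+1 c i *
     (sqr_dist a c g - 2 * a ^+ 2 * ell c i + 2 * a * g i + a ^+ 2)
  <= sqr_dist (a * (1 - n.+1%:R^-1)) c g + drift_const.
Proof.
move=> sc /andP[a0 a1] g0 gd; rewrite (sum_removal_prob_sqr_dist _ _ sc).
set Qw := \sum_(i < d) ell c i ^+ 2 * weight d (ell c) i.
set Lw := \sum_(i < d) g i * ell c i * weight d (ell c) i.
pose Q := \sum_(i < d) ell c i ^+ 2; pose L := \sum_(i < d) g i * ell c i.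
pose C : R := 'C(d, 2)%:R; set N : R := n.+1%:R; set K := drift_const.
have N1 : 1 <= N by rewrite ler1n.
have V0 : 0 <= N^-1 by rewrite invr_ge0; lra.
have x0 := ell_ge0 R d c; have gx := ell_gapped R sc.
have sqr_distE b :
    sqr_dist b c g = b ^+ 2 * Q - 2 * b * L + \sum_(i < d) g i ^+ 2.
  rewrite /sqr_dist !mulr_sumr -sumrB -big_split; apply: eq_bigr => i _ /=.
  by ring.
have Qw_ge : a ^+ 2 * ((Q - d%:R * (N + C)) * N^-1) <= a ^+ 2 * (Qw * N^-1).
  rewrite ler_wpM2l ?sqr_ge0 // ler_wpM2r //.
  by have := sum_sqr_weight_ge gx x0; rewrite (sum_ell R sc).
have Lw_le : a * (Lw * N^-1) <= a * (L * N^-1).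
  by rewrite ler_wpM2l // ler_wpM2r //; exact: sum_nonincreasing_weight_le.
have drift_le : a ^+ 2 * (1 + 2 * (d%:R * (N + C) * N^-1)) <= K.
  have C0 : 0 <= C := ler0n _ _.
  have rate_le : d%:R * (N + C) * N^-1 <= d%:R * (1 + C).
    rewrite ler_pdivrMr -?mulrA; last by lra.
    by rewrite ler_wpM2l //; have := ler_peMr C0 N1; lra.
  have rate_ge0 : 0 <= d%:R * (N + C) * N^-1.
    by rewrite !mulr_ge0 //; lra.
  apply: (@le_trans _ _ (1 + 2 * (d%:R * (N + C) * N^-1))).
    by rewrite ler_piMl ?expr_le1 // addr_ge0 // mulr_ge0.
  by rewrite /K /drift_const -/C -[2 * _ * _]mulrA lerD2l ler_wpM2l.
have square_ge0 : 0 <= a ^+ 2 * Q * N^-1 ^+ 2.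
  by rewrite !mulr_ge0 ?sqr_ge0 ?sumr_ge0 // => i _; exact: sqr_ge0.
rewrite !sqr_distE; move: (\sum_(i < d) g i ^+ 2) => G.
move: Q L C Qw Lw N^-1 K Qw_ge Lw_le drift_le square_ge0 {sqr_distE}.
by move=> Q L C Qw Lw V K; lra.
Qed.

Lemma ell_second_moment m n c : is_shape d n c -> (0 < m <= n)%N ->
  mean (words d n c)
    (fun w => sqr_dist 1 (content (take m w)) (fun i => m%:R / n%:R * ell c i))
  <= drift_const * (n - m)%:R.
Proof.
move=> sc /andP[m0 mn]; set g := fun i : nat => _.
have g0 i : 0 <= g i by rewrite mulr_ge0 ?divr_ge0 ?ell_ge0.
have gd i j : (i <= j)%N -> g j <= g i.
  by move=> ij; rewrite ler_wpM2l ?divr_ge0 ?(ell_nonincreasing _ sc).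
pose B k v := sqr_dist (m%:R / k%:R) v g + drift_const * (k - m)%:R.
suff : mean (words d n c) (fun w => sqr_dist 1 (content (take m w)) g) <= B n c.
  rewrite /B {2}/sqr_dist big1 ?add0r // => i _.
  by rewrite subrr expr0n.
apply: (@mean_words_take_le m (fun w => sqr_dist 1 (content w) g) B) sc => //.
  move=> v w sv /(mem_words w sv)[_ cw].
  rewrite /B subnn mulr0 addr0 divff ?pnatr_eq0 -?lt0n // /sqr_dist.
  by apply: ler_sum => i _; rewrite /ell /first_hook cw.
move=> k v mk sv.
have k0 : 0 < k%:R :> R by rewrite ltr0n (leq_trans m0).
set a : R := m%:R / k%:R; have a01 : 0 <= a <= 1.
  by rewrite divr_ge0 //= ler_pdivrMr // mul1r ler_nat.
pose Bdel i := sqr_dist a v g - 2 * a ^+ 2 * ell v i + 2 * a * g i + a ^+ 2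
  + drift_const * (k - m)%:R.
rewrite (eq_bigr (fun i : 'I_d => removal_prob k.+1 v i * Bdel i)); last first.
  by move=> i vi; rewrite /B sqr_dist_del_cell ?corner_gt0.
rewrite (sum_corner_removal_prob Bdel sv) /Bdel.
under eq_bigr do rewrite mulrDr.
rewrite big_split -mulr_suml /= (sum_removal_prob sv) mul1r.
have := sqr_dist_supermartingale sv a01 g0 gd.
have -> : a * (1 - k.+1%:R^-1) = m%:R / k.+1%:R.
  by rewrite /a -natr1; field; lra.
by rewrite /B subSn // -natr1; lra.
Qed.

Definition moment_const : R := 2 * drift_const + 2 * d%:R ^+ 3.

Lemma moment_const_gt0 : 0 < moment_const.
Proof.
rewrite ltr_pwDl ?mulr_ge0 ?exprn_ge0 // mulr_gt0 // ltr_pwDl //.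
by rewrite !mulr_ge0 // addr_ge0.
Qed.

Lemma content_second_moment m n c : is_shape d n c -> (0 < m <= n)%N ->
  mean (words d n c) (fun w =>
    \sum_(i < d) ((content (take m w) i)%:R - m%:R / n%:R * (c i)%:R) ^+ 2)
  <= moment_const * n%:R.
Proof.
move=> sc mn; have moment := ell_second_moment sc mn; have /andP[m0 mn'] := mn.
set a : R := m%:R / n%:R in moment *.
have n0 : 0 < n%:R :> R by rewrite ltr0n (leq_trans m0).
have n1 : 1 <= n%:R :> R by rewrite ler1n (leq_trans m0).
have a01 : 0 <= a <= 1.
  by rewrite divr_ge0 //= ler_pdivrMr // mul1r ler_nat.
pose shift (i : nat) : R := (1 - a) * (d - i.+1)%:R.
have sqr_le i w : ((content (take m w) i)%:R - a * (c i)%:R) ^+ 2 <=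
    2 * (1 * ell (content (take m w)) i - a * ell c i) ^+ 2 + 2 * d%:R ^+ 2.
  have shift_le : shift i ^+ 2 <= d%:R ^+ 2.
    rewrite lerXn2r ?nnegrE ?mulr_ge0 //; first by lra.
    rewrite -[leRHS]mul1r ler_pM //; try lra.
    by rewrite ler_nat leq_subr.
  have -> : 1 * ell (content (take m w)) i - a * ell c i =
      ((content (take m w) i)%:R - a * (c i)%:R) + shift i.
    by rewrite /ell /first_hook !natrD /shift; ring.
  move: shift_le; set x := _ - _; move: (shift i) => y shift_le.
  by have := sqr_ge0 (x + 2 * y); lra.
apply: (@le_trans _ _ (2 * (drift_const * (n - m)%:R) + 2 * d%:R ^+ 3)).
  apply: le_trans (lerD (ler_wpM2l _ moment) (lexx _)) => //.
  rewrite -meanZ -[X in _ + X](@mean_cst _ _ (words d n c)) ?size_words_gt0 //.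
  rewrite -meanD; apply: ler_mean => w _; rewrite /sqr_dist mulr_sumr.
  have -> : 2 * d%:R ^+ 3 = \sum_(i < d) 2 * d%:R ^+ 2 :> R.
    by rewrite sumr_const card_ord -mulr_natr; ring.
  by rewrite -big_split ler_sum.
have d3 : 2 * d%:R ^+ 3 <= 2 * d%:R ^+ 3 * n%:R :> R.
  by rewrite ler_peMr // mulr_ge0 ?exprn_ge0.
have drift_le : drift_const * (n - m)%:R <= drift_const * n%:R.
  rewrite ler_wpM2l ?ler_nat ?leq_subr //.
  by rewrite addr_ge0 // !mulr_ge0 // addr_ge0.
by rewrite /moment_const; lra.
Qed.

End SecondMoment.

(** * Occurrences and exchanges in a list *)

(* The position in [s] of the [k]-th item satisfying [a], counted from 0; it is
   [size s] if there is no such item. *)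
Fixpoint occurrence (T : Type) (a : pred T) (k : nat) (s : seq T) : nat :=
  if s is x :: s' then
    if a x then if k is k'.+1 then (occurrence a k' s').+1 else 0%N
    else (occurrence a k s').+1
  else 0%N.

Section Occurrences.
Local Open Scope nat_scope.
Variables (T : Type) (x0 : T).
Implicit Types (a : pred T) (s : seq T).

Lemma occurrence_map (S : Type) (f : T -> S) (b : pred S) k s :
  occurrence b k (map f s) = occurrence (preim f b) k s.
Proof.
by elim: s k => //= x s IHs k; rewrite IHs; case: k => // k; rewrite IHs.
Qed.

Lemma occurrence_lt_size a k s : k < count a s -> occurrence a k s < size s.
Proof.
elim: s k => //= x s IHs k; case: (a x); last exact: IHs.
by case: k => // k; exact: IHs.
Qed.

Lemma nth_occurrence a k s : k < count a s -> a (nth x0 s (occurrence a k s)).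
Proof.
elim: s k => //= x s IHs k; case ax: (a x); last exact: IHs.
by case: k => // k; exact: IHs.
Qed.

Lemma count_take_occurrence a k s :
  k <= count a s -> count a (take (occurrence a k s) s) = k.
Proof.
elim: s k => [|x s IHs] k /=; first by rewrite leqn0 => /eqP.
case ax: (a x); last by rewrite /= ax; exact: IHs.
by case: k => //= k /IHs ->; rewrite ax.
Qed.

Lemma occurrence_count_take a s p : p < size s -> a (nth x0 s p) ->
  occurrence a (count a (take p s)) s = p.
Proof.
elim: s p => //= x s IHs [|p] /= ps ap; first by rewrite ap.
by case: (a x); rewrite ?add1n ?add0n IHs.
Qed.

Lemma leq_count_take a s t u : t <= u ->
  count a (take t s) <= count a (take u s).
Proof.
move=> tu; rewrite -(cat_take_drop t (take u s)) count_cat.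
by rewrite take_takel // leq_addr.
Qed.

Lemma count_takeS a s p : p < size s ->
  count a (take p.+1 s) = count a (take p s) + a (nth x0 s p).
Proof. by move=> ps; rewrite (take_nth x0) // -cats1 count_cat /= addn0. Qed.

Lemma count_take_ltE a s p t : p < size s -> a (nth x0 s p) ->
  (count a (take p s) < count a (take t s)) = (p < t).
Proof.
move=> ps ap; have [pt|tp] := ltnP p t; last by rewrite ltnNge leq_count_take.
by apply: leq_trans (leq_count_take _ _ pt); rewrite count_takeS // ap addn1.
Qed.

Lemma count_take_sum a s t :
  count a (take t s) = \sum_(p < size s) (p < t) * a (nth x0 s p).
Proof.
elim: s t => [|x s IHs] t /=; first by rewrite big_ord0.
rewrite big_ord_recl; case: t => [|t] /=; last by rewrite mul1n IHs.
by rewrite big1.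
Qed.

Lemma count_drop_sum a s t :
  count a (drop t s) = \sum_(p < size s) (t <= p) * a (nth x0 s p).
Proof.
elim: s t => [|x s IHs] t /=; first by rewrite big_ord0.
rewrite big_ord_recl; case: t => [|t] /=; last by rewrite IHs.
by rewrite mul1n -[in LHS](drop0 s) IHs.
Qed.

Definition exchange s p q :=
  set_nth x0 (set_nth x0 s p (nth x0 s q)) q (nth x0 s p).

Section Exchange.
Variables (s : seq T) (p q : nat).
Hypotheses (ps : p < size s) (qs : q < size s).

Lemma size_exchange : size (exchange s p q) = size s.
Proof. by rewrite !size_set_nth !(maxn_idPr _) // (maxn_idPr ps). Qed.

Lemma nth_exchange r : nth x0 (exchange s p q) r =
  if r == q then nth x0 s p else if r == p then nth x0 s q else nth x0 s r.
Proof. by rewrite nth_set_nth /= nth_set_nth. Qed.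

Lemma map_exchange (S : Type) (f : T -> S) :
  f (nth x0 s p) = f (nth x0 s q) -> map f (exchange s p q) = map f s.
Proof.
move=> fpq; apply: (@eq_from_nth _ (f x0)) => [|r].
  by rewrite !size_map size_exchange.
rewrite size_map size_exchange // => rs.
rewrite !(nth_map x0) ?size_exchange // nth_exchange.
by have [->|_] := eqVneq r q; last have [->|] := eqVneq r p.
Qed.

End Exchange.

Lemma exchangeK s p q : p < size s -> q < size s ->
  exchange (exchange s p q) p q = s.
Proof.
move=> ps qs; have sz := size_exchange ps qs.
apply: (@eq_from_nth _ x0); rewrite size_exchange ?sz // => r rs.
rewrite !nth_exchange !eqxx.
have [->|_] := eqVneq r q; first by case: eqVneq => [->|].
by case: eqVneq => [->|].
Qed.

Lemma count_take_set_nth a s p x t : p < size s ->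
  count a (take t (set_nth x0 s p x)) + (p < t) * a (nth x0 s p) =
  count a (take t s) + (p < t) * a x.
Proof.
elim: s p t => // y s IHs [|p] [|t] //= ps; first by rewrite !mul1n; lia.
by have := IHs p t ps; rewrite ltnS; lia.
Qed.

Lemma count_take_exchange a s p q t : p != q -> p < size s -> q < size s ->
  count a (take t (exchange s p q))
    + ((p < t) * a (nth x0 s p) + (q < t) * a (nth x0 s q)) =
  count a (take t s) + ((p < t) * a (nth x0 s q) + (q < t) * a (nth x0 s p)).
Proof.
move=> pq ps qs.
have qs' : q < size (set_nth x0 s p (nth x0 s q)).
  by rewrite size_set_nth (maxn_idPr ps).
have := count_take_set_nth a (nth x0 s p) t qs'.
have := count_take_set_nth a (nth x0 s q) t ps.
by rewrite nth_set_nth /= eq_sym (negPf pq) /exchange; lia.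
Qed.

End Occurrences.

(** * Letters of the first and the last row *)

Section Stars.
Local Open Scope nat_scope.
Variables (e k : nat).
Hypothesis e_gt0 : 0 < e.
Implicit Types (w : seq nat).

Definition star : pred nat := fun x => (x == 0) || (x == e).

Definition cut w := occurrence star k w.

Definition early_last w := content (take (cut w) w) e.

Lemma count_star w : count star w = content w 0 + content w e.
Proof.
rewrite /content; elim: w => //= x w ->; rewrite /star.
by case: eqVneq => [->|_] /=; rewrite ?(gtn_eqF e_gt0) //=; lia.
Qed.

Lemma early_first_add_last w : k <= count star w ->
  content (take (cut w) w) 0 + early_last w = k.
Proof. by move=> kw; rewrite -count_star count_take_occurrence. Qed.

Lemma early_last_dichotomy w m z : k <= count star w -> early_last w <= z ->
  k <= content (take m w) 0 + z \/ content (take m w) e <= z.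
Proof.
move=> /early_first_add_last kE hz; have [mt|tm] := leqP m (cut w).
  by right; apply: leq_trans hz; exact: leq_count_take.
left; rewrite -{1}kE leq_add //; exact/leq_count_take/ltnW.
Qed.

End Stars.

Lemma first_before_last e w p q a b : (0 < e)%N ->
  (p < size w)%N -> (q < size w)%N ->
  nth 0%N w p = 0%N -> nth 0%N w q = e ->
  content (take p w) 0 = a -> content (take q w) e = b ->
  (p < q)%N = (early_last e (a + b).+1 w <= b)%N.
Proof.
move=> e0 pw qw wp wq ca cb.
have content_lt x r t : (r < size w)%N -> nth 0%N w r = x ->
    (content (take r w) x < content (take t w) x)%N = (r < t)%N.
  by move=> rw wr; apply: (count_take_ltE (x0 := 0%N)); rewrite /= ?wr.
have full r x : (r < size w)%N -> nth 0%N w r = x ->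
    (content (take r w) x < content w x)%N.
  by move=> rw wr; rewrite -{2}(take_size w) content_lt.
have k_le : ((a + b).+1 <= count (star e) w)%N.
  by rewrite count_star //; have := full p _ pw wp; have := full q _ qw wq; lia.
have p_cut := content_lt 0%N p (cut e (a + b).+1 w) pw wp.
have q_cut := content_lt e q (cut e (a + b).+1 w) qw wq.
rewrite ca cb in p_cut q_cut; move: p_cut q_cut (early_first_add_last e0 k_le).
by rewrite /early_last; lia.
Qed.

(** * Counting exchanges *)

Section ExchangeCount.
Local Open Scope nat_scope.
Variables (e k n : nat) (c : nat -> nat).
Hypotheses (e_gt0 : 0 < e) (sc : is_shape e.+1 n c) (kc : k <= c 0 + c e).
Implicit Types (w : seq nat).

Local Notation W := (words e.+1 n c).

Lemma leq_count_star w : w \in W -> k <= count (star e) w.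
Proof. by case/(mem_words w sc)=> _ cw; rewrite count_star // !cw. Qed.

Lemma exchange_ballot w p q : ballot w -> content w e.+1 = 0 ->
  p < q -> q < size w -> nth 0 w p = e -> nth 0 w q = 0 ->
  ballot (exchange 0 w p q).
Proof.
move=> bw we pq qw wp wq t x; have pw := ltn_trans pq qw.
have count_t y := count_take_exchange 0 (pred1 y) t (negbT (ltn_eqF pq)) pw qw.
have we_t : content (take t w) e.+1 = 0.
  by apply/eqP; rewrite -leqn0 -we -(content_take_drop t w) leq_addr.
have qt_pt : (q < t) <= (p < t) by case: (ltnP q t) => // /(ltn_trans pq) ->.
move: (count_t x) (count_t x.+1) (bw t x) we_t; rewrite /content wp wq /=.
have [<-|ex] := eqVneq e x; first by rewrite (ltn_eqF (ltnSn e)); lia.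
by case: (eqVneq e x.+1); case: (eqVneq 0 x); lia.
Qed.

Lemma cut_exchange w p q : p < size w -> q < size w ->
  nth 0 w p = e -> nth 0 w q = 0 -> cut e k (exchange 0 w p q) = cut e k w.
Proof.
move=> pw qw wp wq; rewrite /cut -!(occurrence_map (star e) id).
by rewrite map_exchange // wp wq /star !eqxx orbT.
Qed.

Lemma exchange_words w p q : w \in W -> p < q < n ->
  nth 0 w p = e -> nth 0 w q = 0 -> exchange 0 w p q \in W.
Proof.
move=> wW /andP[pq qn] wp wq; have [bw cw] := (mem_words w sc).1 wW.
have qw : q < size w by rewrite (size_mem_words wW).
have pw := ltn_trans pq qw; have pq' : p != q by rewrite ltn_eqF.
apply/(mem_words _ sc); split=> [|x].
  by apply: exchange_ballot; rewrite // cw (shape_eq0 sc).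
have := count_take_exchange 0 (pred1 x) (size w) pq' pw qw.
rewrite pw qw !take_oversize ?size_exchange // -cw.
by rewrite [X in _ = _ + X]addnC => /addIn.
Qed.

Definition separated i x y p q w := [&& early_last e k w == i,
  (p < cut e k w) && (nth 0 w p == x) & (cut e k w <= q) && (nth 0 w q == y)].

Lemma exchange_separated j p q w : w \in W -> q < n ->
  separated j.+1 e 0 p q w -> separated j 0 e p q (exchange 0 w p q).
Proof.
move=> wW qn /and3P[/eqP hj /andP[pc /eqP wp] /andP[qc /eqP wq]].
have pq := leq_trans pc qc; have qw : q < size w by rewrite (size_mem_words wW).
have pw := ltn_trans pq qw.
have := count_take_exchange 0 (pred1 e) (cut e k w) (negbT (ltn_eqF pq)) pw qw.
rewrite /separated /early_last cut_exchange // pc qc !nth_exchange //.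
rewrite eqxx (ltn_eqF pq) wp wq !eqxx /= andbT.
rewrite -[count _ (take _ w)]/(early_last e k w) hj eqxx.
by rewrite ltnNge qc (ltn_eqF e_gt0) /content /=; lia.
Qed.

Lemma leq_count_separated j p q : q < n ->
  count (separated j.+1 e 0 p q) W <= count (separated j 0 e p q) W.
Proof.
move=> qn; rewrite -!size_filter -(size_map (fun w => exchange 0 w p q)).
have sizes w : w \in W -> separated j.+1 e 0 p q w -> p < q < size w.
  move=> wW /and3P[_ /andP[pc _] /andP[qc _]].
  by rewrite (size_mem_words wW) qn (leq_trans pc).
apply: uniq_leq_size.
  rewrite map_inj_in_uniq ?filter_uniq ?words_uniq //.
  apply: (can_in_inj (g := fun w => exchange 0 w p q)) => w; rewrite mem_filter.
  case/andP=> sw /sizes/(_ sw)/andP[pq qw].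
  by rewrite exchangeK ?(ltn_trans pq).
move=> _ /mapP[w + ->]; rewrite !mem_filter => /andP[sw wW].
have pqn := sizes w wW sw; rewrite (size_mem_words wW) in pqn.
rewrite exchange_separated //=; case/and3P: sw => _ /andP[_ /eqP wp].
by case/andP=> _ /eqP wq; exact: exchange_words.
Qed.

Lemma sum_count_separated i x y :
  \sum_(p < n) \sum_(q < n) count (separated i x y p q) W =
  \sum_(w <- W | early_last e k w == i)
    content (take (cut e k w) w) x * content (drop (cut e k w) w) y.
Proof.
under [LHS]eq_bigr => p _.
  under eq_bigr => q _ do rewrite -sum1_count big_mkcond.
  over.
under eq_bigr => p _ do rewrite exchange_big.
rewrite exchange_big [RHS]big_mkcond /=.
apply: eq_big_seq => w wW; rewrite /separated; case: eqP => _; last first.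
  by rewrite big1 // => p _; rewrite big1.
rewrite /content (count_take_sum 0) (count_drop_sum 0) (size_mem_words wW).
rewrite big_distrlr; apply: eq_bigr => p _; apply: eq_bigr => q _ /=.
by rewrite !mulnb; case: ifP.
Qed.

Lemma sum_count_separated_cst i x y B :
  (forall w, w \in W -> early_last e k w = i ->
     content (take (cut e k w) w) x * content (drop (cut e k w) w) y = B) ->
  \sum_(p < n) \sum_(q < n) count (separated i x y p q) W =
  count (fun w => early_last e k w == i) W * B.
Proof.
move=> cst; rewrite sum_count_separated big_seq_cond.
rewrite (eq_bigr (fun=> B)) => [|w /andP[wW /eqP]]; last exact: cst.
by rewrite -big_seq_cond big_const_seq iter_addn_0 mulnC.
Qed.

(* Exchanging a last-row letter before the cut with a first-row letter after it
   preserves the ballot condition; the two sides count the pairs of positions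
   before and after such an exchange. *)
Lemma early_last_exchange j :
  count (fun w => early_last e k w == j.+1) W * (j.+1 * (c 0 - (k - j.+1))) <=
  count (fun w => early_last e k w == j) W * ((k - j) * (c e - j)).
Proof.
have letters w i : w \in W -> early_last e k w = i ->
    [/\ content (take (cut e k w) w) e = i,
        content (take (cut e k w) w) 0 = k - i,
        content (drop (cut e k w) w) e = c e - i
      & content (drop (cut e k w) w) 0 = c 0 - (k - i)].
  move=> wW hw; have [_ cw] := (mem_words w sc).1 wW.
  have := early_first_add_last e_gt0 (leq_count_star wW).
  move: hw; rewrite /early_last.
  have := content_take_drop (cut e k w) w 0.
  have := content_take_drop (cut e k w) w e.
  by rewrite !cw => last_split first_split hw kE; split; lia.
rewrite -(@sum_count_separated_cst _ e 0); last first.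
  by move=> w wW /(letters w _ wW)[-> _ _ ->].
rewrite -(@sum_count_separated_cst _ 0 e); last first.
  by move=> w wW /(letters w _ wW)[_ -> -> _].
by apply: leq_sum => p _; apply: leq_sum => q _; exact: leq_count_separated.
Qed.

End ExchangeCount.

(** * Linear extensions as ballot words *)

Section PairProbabilities.
Context {disp : Order.disp_t} {T : finPOrderType disp}.
Variable R : realType.
Implicit Types (x y : T).

Lemma pr_ltC x y : x != y -> (0 < #|lin_ext T|)%N ->
  pr_lt R x y + pr_lt R y x = 1.
Proof.
move=> xy ext0; rewrite /pr_lt -mulrDl -natrD.
suff -> : (#|[set L in lin_ext T | (L x < L y)%N]|
    + #|[set L in lin_ext T | (L y < L x)%N]|)%N = #|lin_ext T|.
  by rewrite divff // pnatr_eq0 -lt0n.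
rewrite -(cardsID [set L : {ffun T -> 'I_#|T|} | (L x < L y)%N] (lin_ext T)).
congr (_ + _)%N; first by apply: eq_card => L; rewrite !in_set.
apply: eq_card => L; rewrite in_setD in_set [in RHS]in_set.
case: (boolP (L \in lin_ext T)) => [/lin_extP[bL _]|_]; rewrite ?andbF //=.
rewrite andbT -leqNgt [RHS]leq_eqVlt; case: eqP => // /val_inj/(bij_inj bL) yx.
by rewrite yx eqxx in xy.
Qed.

Lemma delta_pairE x y : x != y -> (0 < #|lin_ext T|)%N ->
  delta_pair R x y = `|2 * pr_lt R x y - 1|.
Proof.
by move=> xy /(pr_ltC xy) sum1; rewrite /delta_pair; congr `|_|; lra.
Qed.

End PairProbabilities.

Section Tableaux.
Local Open Scope nat_scope.
Variables (n : nat) (lam : seq nat).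
Hypothesis lamP : is_partition n lam.
Local Notation d := (size lam).
Local Notation c := (nth 0 lam).
Local Notation T := (young lam : finPOrderType young_display).
Implicit Types (L : {ffun T -> 'I_#|T|}) (x y : T) (w : seq nat).

Lemma partition_shape : is_shape d n c.
Proof.
case/and3P: lamP => /(sortedP 0) sl _ /eqP <-; split; last first.
- by rewrite sumnE (big_nth 0) big_mkord.
- by rewrite nth_default.
by move=> i; have [/sl//|di] := ltnP i.+1 d; rewrite [leqLHS]nth_default.
Qed.

Lemma partition_gt0 : 0 < d -> 0 < n.
Proof.
move=> d0; apply: leq_trans (leq_shape partition_shape d0).
by case/and3P: lamP => _ /allP all1 _; exact/all1/mem_nth.
Qed.

Lemma card_young : #|T| = n.
Proof. by case: partition_shape => _ _ <-; exact: tagnat.card. Qed.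

Definition cell (i : 'I_d) (j : 'I_(c i)) : T := existT _ i j.

Lemma young_inj x y :
  young_row x = young_row y -> young_col x = young_col y -> x = y.
Proof.
by move=> xy1 xy2; apply: young_le_anti; rewrite /young_le xy1 xy2 !leqnn.
Qed.

Lemma young_lt x y : x != y -> young_le x y -> (x < y)%O.
Proof. by move=> xy le_xy; rewrite lt_neqAle xy. Qed.

Definition reading L : seq nat :=
  [seq (if [pick x | L x == t] is Some x then young_row x else 0)
  | t <- enum 'I_#|T|].

Lemma size_reading L : size (reading L) = n.
Proof. by rewrite size_map size_enum_ord card_young. Qed.

Lemma ltn_size_reading L x : L x < size (reading L).
Proof. by rewrite size_reading -[X in _ < X]card_young. Qed.

Lemma nth_reading L x : injective L -> nth 0 (reading L) (L x) = young_row x.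
Proof.
move=> iL; rewrite (nth_map (L x)) ?size_enum_ord // nth_ord_enum.
by case: pickP => [y /eqP/iL ->|/(_ x)] //; rewrite eqxx.
Qed.

Lemma content_reading L (i s : nat) : bijective L ->
  content (take s (reading L)) i = \sum_(x : T | young_row x == i) (L x < s).
Proof.
move=> bL; rewrite /content (count_take_sum 0) size_reading -card_young.
rewrite (reindex L) /=; last by case: bL => g gL Lg; exists g => z _.
rewrite [RHS]big_mkcond /=; apply: eq_bigr => x _.
by rewrite (nth_reading _ (bij_inj bL)) mulnC; case: eqP; rewrite ?mul1n.
Qed.

Lemma content_reading_row L (i : 'I_d) s : bijective L ->
  content (take s (reading L)) i = \sum_(j < c i) (L (cell j) < s).
Proof.
move=> bL; rewrite content_reading //.
have -> : \sum_(j < c i) (L (cell j) < s) =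
    \sum_(i' < d | i' == i) \sum_(j < c i') (L (cell j) < s).
  by rewrite big_pred1_eq.
rewrite (sig_big_dep _ _ (fun (i' : 'I_d) (j : 'I_(c i')) =>
  nat_of_bool (L (cell j) < s))) /=.
apply: eq_big => [[i' j]|[i' j]] //.
by rewrite andbT /young_row /= -val_eqE.
Qed.

Lemma content_reading_eq0 L i s : bijective L -> d <= i ->
  content (take s (reading L)) i = 0.
Proof.
move=> bL di; rewrite content_reading // big1 // => x /eqP xi.
by have := ltn_ord (tag x); rewrite -[nat_of_ord _]/(young_row x) xi ltnNge di.
Qed.

Lemma content_reading_cell L x : L \in lin_ext T ->
  content (take (L x) (reading L)) (young_row x) = young_col x.
Proof.
case/lin_extP=> bL mL; case: x => i j.
have row_lt (j1 j2 : 'I_(c i)) : j1 < j2 -> L (cell j1) < L (cell j2).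
  move=> j12; apply/mL/young_lt; last by rewrite /young_le leqnn ltnW.
  apply: contraTneq j12 => /(congr1 (@young_col lam)).
  by rewrite /young_col /= => ->; rewrite ltnn.
have colE : \sum_(j' < c i | j' < j) 1 = j.
  by rewrite (big_ord_narrow (ltnW (ltn_ord j))) sum_nat_const card_ord muln1.
rewrite (content_reading_row i _ bL) [RHS]/young_col /= -[RHS]colE.
rewrite [RHS]big_mkcond /=; apply: eq_bigr => j' _.
rewrite -[existT _ i j]/(cell j).
have [/row_lt ->//|jj'] := ltnP j' j; apply/eqP; rewrite eqb0 -leqNgt.
by move: jj'; rewrite leq_eqVlt => /predU1P[/val_inj->|/row_lt/ltnW].
Qed.

Lemma reading_ballot L : L \in lin_ext T -> ballot (reading L).
Proof.
case/lin_extP=> bL mL s i.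
have [id|di] := ltnP i.+1 d; last by rewrite content_reading_eq0.
rewrite (content_reading_row (Ordinal id)) //.
rewrite (content_reading_row (Ordinal (ltnW id))) //=.
have ci : c i.+1 <= c i by case: partition_shape.
rewrite [leqRHS](bigID (fun j : 'I_(c i) => j < c i.+1)) /=.
apply: leq_trans (leq_addr _ _); rewrite big_ord_narrow; apply: leq_sum => j _.
set x := cell (j : 'I_(c (Ordinal id))).
set y := cell (_ : 'I_(c (Ordinal (ltnW id)))).
suff /mL xy : (y < x)%O.
  by case: (ltnP (L x)) => // xs; rewrite (ltn_trans xy xs).
apply: young_lt; last first.
  by rewrite /young_le /young_row /young_col /= leqnSn leqnn.
by apply/eqP => /(congr1 (@young_row lam))/eqP; rewrite /young_row /= ltn_eqF.
Qed.

Lemma reading_words L : L \in lin_ext T -> reading L \in words d n c.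
Proof.
move=> LT; have /lin_extP[bL _] := LT; apply/(mem_words _ partition_shape).
split=> [|i]; first exact: reading_ballot.
rewrite -(take_size (reading L)); have [id|di] := ltnP i d; last first.
  by rewrite content_reading_eq0 // nth_default.
rewrite (content_reading_row (Ordinal id)) // (eq_bigr (fun=> 1)) => [|j _].
  by rewrite sum_nat_const card_ord muln1.
by rewrite ltn_size_reading.
Qed.

Lemma occurrence_reading L x : L \in lin_ext T ->
  occurrence (pred1 (young_row x)) (young_col x) (reading L) = L x.
Proof.
move=> LT; have /lin_extP[/bij_inj iL _] := LT.
rewrite -(content_reading_cell x LT).
by rewrite (occurrence_count_take (x0 := 0)) ?ltn_size_reading //= nth_reading.
Qed.

Lemma reading_inj : {in lin_ext T &, injective reading}.
Proof.
move=> L1 L2 LT1 LT2 eq_L; apply/ffunP => x; apply/val_inj => /=.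
by rewrite -(occurrence_reading x LT1) eq_L occurrence_reading.
Qed.

Section Labelling.
Variable w : seq nat.
Hypothesis ww : w \in words d n c.

Definition labelling : {ffun T -> 'I_#|T|} := [ffun x =>
  insubd (enum_rank x) (occurrence (pred1 (young_row x)) (young_col x) w)].

Lemma young_col_lt_content x : young_col x < content w (young_row x).
Proof.
have [_ ->] := (mem_words w partition_shape).1 ww.
by case: x => i j; exact: ltn_ord.
Qed.

Lemma val_labelling x :
  labelling x = occurrence (pred1 (young_row x)) (young_col x) w :> nat.
Proof.
rewrite ffunE val_insubd [X in _ < X]card_young -(size_mem_words ww).
by rewrite occurrence_lt_size ?young_col_lt_content.
Qed.

Lemma nth_labelling x : nth 0 w (labelling x) = young_row x.
Proof.
rewrite val_labelling; apply/eqP.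
exact: (nth_occurrence 0 (young_col_lt_content x)).
Qed.

Lemma content_labelling x :
  content (take (labelling x) w) (young_row x) = young_col x.
Proof.
rewrite val_labelling; apply: count_take_occurrence.
exact/ltnW/young_col_lt_content.
Qed.

Lemma labelling_inj : injective labelling.
Proof.
move=> x y xy.
have rxy : young_row x = young_row y by rewrite -!nth_labelling xy.
by apply: young_inj => //; rewrite -!content_labelling xy rxy.
Qed.

Lemma labelling_lin_ext : labelling \in lin_ext T.
Proof.
have [bw _] := (mem_words w partition_shape).1 ww.
apply/lin_extP; split=> [|x y xy].
  by apply: inj_card_bij labelling_inj _; rewrite card_ord.
have /andP[rxy cxy] := ltW xy; rewrite ltnNge leq_eqVlt negb_or -leqNgt.
have -> /= : labelling y != labelling x :> nat.
  by rewrite val_eqE (inj_eq labelling_inj) gt_eqF.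
have rows_le t :
    content (take t w) (young_row y) <= content (take t w) (young_row x).
  rewrite -(subnKC rxy); elim: (_ - _) => [|i IHi]; first by rewrite addn0.
  by rewrite addnS (leq_trans (bw t _) IHi).
have y_size : labelling y < size w.
  by rewrite (size_mem_words ww) -[X in _ < X]card_young.
have y_row : pred1 (young_row y) (nth 0 w (labelling y)).
  by rewrite /= nth_labelling.
rewrite leqNgt -(count_take_ltE _ y_size y_row) -leqNgt.
rewrite -/(content _ _) -/(content _ _) content_labelling.
by apply: leq_trans (rows_le _) _; rewrite content_labelling.
Qed.

Lemma reading_labelling : reading labelling = w.
Proof.
have /lin_extP[[g _ gL] _] := labelling_lin_ext.
apply: (@eq_from_nth _ 0); first by rewrite size_reading (size_mem_words ww).
move=> t; rewrite size_reading -{1}card_young => tT.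
rewrite -[t]/(nat_of_ord (Ordinal tT)) -[Ordinal tT]gL nth_labelling.
exact/nth_reading/labelling_inj.
Qed.

End Labelling.

Lemma perm_reading_words :
  perm_eq [seq reading L | L <- enum (lin_ext T)] (words d n c).
Proof.
apply: uniq_perm (words_uniq _ _ _) _ => [|w].
  rewrite map_inj_in_uniq ?enum_uniq // => L1 L2.
  by rewrite !mem_enum; exact: reading_inj.
apply/mapP/idP => [[L]|ww].
  by rewrite mem_enum => LT ->; exact: reading_words.
exists (labelling w); last by rewrite reading_labelling.
by rewrite mem_enum labelling_lin_ext.
Qed.

Lemma card_lin_ext_reading (P : pred (seq nat)) :
  #|[set L in lin_ext T | P (reading L)]| = count P (words d n c).
Proof.
rewrite -(permP perm_reading_words) count_map -size_filter cardE.
apply/perm_size/uniq_perm => [||L].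
- exact: enum_uniq.
- exact/filter_uniq/enum_uniq.
by rewrite mem_enum mem_filter mem_enum !inE andbC.
Qed.

Lemma card_lin_ext_young : #|lin_ext T| = size (words d n c).
Proof. by rewrite cardE -(perm_size perm_reading_words) size_map. Qed.

Lemma pr_lt_first_row (R : realType) x y : young_row x = 0 -> 0 < young_row y ->
  pr_lt R x y = cdf R (words d n c)
    (early_last (young_row y) (young_col x + young_col y).+1) (young_col y).
Proof.
move=> rx ry; rewrite /cdf probE -card_lin_ext_reading.
rewrite /pr_lt card_lin_ext_young; congr (_%:R / _)%R.
apply: eq_card => L; rewrite !in_set.
case: (boolP (L \in lin_ext T)) => [LT|]; last by rewrite in_set => /negPf ->.
have := LT; rewrite in_set => -> /=; have /lin_extP[/bij_inj iL _] := LT.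
apply: first_before_last;
  rewrite ?ltn_size_reading ?nth_reading ?content_reading_cell //.
by rewrite -[0]rx content_reading_cell.
Qed.

Lemma delta_le_first_row (R : realType) x y :
  young_row x = 0 -> 0 < young_row y ->
  (delta T R <= `|2 * cdf R (words d n c)
                      (early_last (young_row y) (young_col x + young_col y).+1)
                      (young_col y) - 1|)%R.
Proof.
move=> rx ry; have xy : x != y by apply: contraTneq ry => <-; rewrite rx.
have [_ /(_ _ _ xy)/le_trans] := delta_min R xy; apply.
rewrite delta_pairE ?pr_lt_first_row // card_lin_ext_young.
exact: size_words_gt0 partition_shape.
Qed.

End Tableaux.

(** * The distribution of the early last-row letters *)

Lemma shifted_ratio_le (R : realFieldType) (x y B : R) : 0 < x <= y -> 0 <= B ->
  (1 - 4 * B / x) * ((x + B) * (y + B)) <= (x - B) * (y - B).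
Proof.
case/andP=> x0 xy B0; have -> : 4 * B / x = 4 * (B / x) by ring.
have BE : B = B / x * x by rewrite divfK // gt_eqF.
have : 0 <= B / x by rewrite divr_ge0 // ltW.
move: (B / x) BE => b -> b0.
have gap0 : 0 <= b * x * (y - x) by rewrite !mulr_ge0 //; lra.
have cubic0 : 0 <= b ^+ 2 * x * (x + y + b * x).
  by rewrite !mulr_ge0 ?sqr_ge0 ?addr_ge0 ?mulr_ge0 //; lra.
by lra.
Qed.

Section EarlyLast.
Variables (R : realFieldType) (e n : nat) (c : nat -> nat).
Hypothesis sc : is_shape e.+1 n c.
Implicit Types (w : seq nat).

Local Notation W := (words e.+1 n c).

Definition half_stars := ((c 0 + c e)./2)%N.
Local Notation k := half_stars.
Local Notation early := (early_last e k).

Lemma last_le_first : (c e <= c 0)%N.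
Proof. exact: shape_nonincreasing sc (leq0n e). Qed.

Lemma half_stars_bounds :
  (k%:R * 2 <= (c 0)%:R + (c e)%:R :> R) /\
  ((c 0)%:R + (c e)%:R <= k%:R * 2 + 1 :> R).
Proof.
have : (k * 2 <= c 0 + c e <= k * 2 + 1)%N by rewrite /half_stars; lia.
by case/andP; rewrite -!(ler_nat R) !natrD !natrM.
Qed.

Lemma half_stars_le_first : (k <= c 0)%N.
Proof. by have := last_le_first; rewrite /half_stars; lia. Qed.

Lemma half_stars_le : (k <= c 0 + c e)%N.
Proof. exact: leq_trans half_stars_le_first (leq_addr _ _). Qed.

Hypothesis e_gt0 : (0 < e)%N.

Lemma early_bounds w : w \in W -> (early w <= k)%N /\ (early w <= c e)%N.
Proof.
move=> wW; have [_ cw] := (mem_words w sc).1 wW.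
have kw := leq_count_star e_gt0 sc half_stars_le wW; split.
  by rewrite -[X in (_ <= X)%N](early_first_add_last e_gt0 kw) leq_addl.
by rewrite -cw -(content_take_drop (cut e k w)) leq_addr.
Qed.

Lemma early_deviation m (delta : R) z w : w \in W ->
  (m * 2 <= n <= m * 2 + 1)%N -> (0 < n)%N -> 1 <= delta ->
  z%:R <= (c e)%:R / 2 - delta -> (early w <= z)%N ->
  (delta / 2) ^+ 2 <=
    \sum_(i < e.+1) ((content (take m w) i)%:R - m%:R / n%:R * (c i)%:R) ^+ 2.
Proof.
move=> wW /andP[+ +] n0 delta1 z_le hz.
rewrite -!(ler_nat R) natrM natrD natrM => m_le m_ge.
have N0 : 0 < n%:R :> R by rewrite ltr0n.
set a : R := m%:R / n%:R.
have aN : a * n%:R = m%:R by rewrite /a divfK // gt_eqF.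
have a_le : a <= 1 / 2 by rewrite /a ler_pdivrMr //; lra.
have one_row (i : 'I_e.+1) :
    delta / 2 <= `|(content (take m w) i)%:R - a * (c i)%:R| ->
    (delta / 2) ^+ 2 <=
      \sum_(i < e.+1) ((content (take m w) i)%:R - a * (c i)%:R) ^+ 2.
  move=> dev; rewrite (bigD1 i) //=.
  apply: (@le_trans _ _ (((content (take m w) i)%:R - a * (c i)%:R) ^+ 2)).
    by rewrite -[leRHS]real_normK ?num_real // lerXn2r ?nnegrE //; lra.
  by rewrite lerDl sumr_ge0 // => j _; rewrite sqr_ge0.
have [_ k_ge] := half_stars_bounds.
have kw := leq_count_star e_gt0 sc half_stars_le wW.
case: (early_last_dichotomy e_gt0 m kw hz).
  rewrite -(ler_nat R) natrD => first_ge; apply: (one_row ord0).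
  have : a * (c 0%N)%:R <= 1 / 2 * (c 0%N)%:R by rewrite ler_wpM2r.
  by move=> first_le; apply: le_trans (ler_norm _); rewrite /=; lra.
rewrite -(ler_nat R) => last_le; apply: (one_row ord_max).
have : (1 / 2 - a) * (c e)%:R <= (1 / 2 - a) * n%:R.
  by apply: ler_wpM2l; [lra|rewrite ler_nat (leq_shape sc)].
move=> last_ge; rewrite distrC; apply: le_trans (ler_norm _).
by rewrite /=; lra.
Qed.

Lemma early_tail_le (delta : R) z : (1 < n)%N -> 1 <= delta ->
  z%:R <= (c e)%:R / 2 - delta ->
  delta ^+ 2 * cdf R W early z <= 4 * (moment_const R e.+1 * n%:R).
Proof.
move=> n1 delta1 z_le; pose m := n./2.
have m_half : (m * 2 <= n <= m * 2 + 1)%N by rewrite /m; lia.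
have m_pos : (0 < m <= n)%N by rewrite /m; lia.
have moment := content_second_moment R sc m_pos.
have : (delta / 2) ^+ 2 * cdf R W early z <= moment_const R e.+1 * n%:R.
  apply: le_trans moment; apply: markov_inequality => w wW.
    by apply: sumr_ge0 => i _; rewrite sqr_ge0.
  by apply: early_deviation; rewrite // ltnW.
by lra.
Qed.

Lemma lower_median_early_ge (delta : R) b : (1 < n)%N -> 1 <= delta ->
  8 * moment_const R e.+1 * n%:R < delta ^+ 2 ->
  lower_median R W early b -> (c e)%:R / 2 - delta <= b%:R.
Proof.
move=> n1 delta1 delta_big [half _]; rewrite leNgt; apply/negP => /ltW b_le.
have := early_tail_le n1 delta1 b_le.
by have := ler_wpM2l (sqr_ge0 delta) half; lra.
Qed.

Lemma early_atom_ratio (B : R) j : (j.+1 <= k)%N -> (j.+1 <= c e)%N ->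
  0 <= B <= (c e)%:R / 2 -> (c e)%:R / 2 - B + 1 <= j.+1%:R ->
  (1 - 8 * B / (c e)%:R) * atom R W early j.+1 <= atom R W early j.
Proof.
move=> jk jc /andP[B0 B_le] j_ge.
have c0 : 0 < (c e)%:R :> R by rewrite ltr0n (leq_trans _ jc).
have [k_le k_ge] := half_stars_bounds.
set x : R := (c e)%:R / 2; set y : R := (c 0%N)%:R / 2.
have xy : 0 < x <= y by rewrite /x /y ler_pM2r ?ler_nat ?last_le_first //; lra.
have -> : 8 * B / (c e)%:R = 4 * B / x by rewrite /x; field; lra.
rewrite /atom !probE !mulrA ler_wpM2r ?invr_ge0 //.
have kj_le : (k - j.+1 <= c 0)%N.
  exact: leq_trans (leq_subr _ _) half_stars_le_first.
have := early_last_exchange e_gt0 sc half_stars_le j.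
rewrite -(ler_nat R) !natrM !natrB ?(ltnW jk) ?(ltnW jc) //.
set u' := (count _ _)%:R; set u := (count _ _)%:R => exchange_le.
have u'0 : 0 <= u' by exact: ler0n.
have u0 : 0 <= u by exact: ler0n.
have /andP[x0 x_le_y] := xy.
have shifted_gt0 : 0 < (x + B) * (y + B) by apply: mulr_gt0; lra.
rewrite -(ler_pM2r shifted_gt0).
have lower : (x - B) * (y - B) <= j.+1%:R * ((c 0%N)%:R - (k%:R - j.+1%:R)).
  by rewrite /x /y in B_le j_ge x_le_y *; apply: ler_pM; lra.
have upper : (k%:R - j%:R) * ((c e)%:R - j%:R) <= (y + B) * (x + B).
  have jk' : j%:R + 1 <= k%:R :> R by rewrite natr1 ler_nat.
  have jc' : j%:R + 1 <= (c e)%:R :> R by rewrite natr1 ler_nat.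
  rewrite -[j.+1%:R]natr1 /x /y in j_ge *.
  by apply: ler_pM; lra.
have := ler_wpM2l u'0 (shifted_ratio_le xy B0).
have := ler_wpM2l u'0 lower; have := ler_wpM2l u0 upper.
by lra.
Qed.

Lemma early_atom_le (delta : R) S w : w \in W -> 0 <= delta ->
  (c e)%:R / 2 - delta <= (early w)%:R ->
  16 * (delta + S%:R + 1) * S%:R <= (c e)%:R ->
  S.+1%:R / 2 * atom R W early (early w) <= 1.
Proof.
move=> wW delta0; have [b_le_k b_le_c] := early_bounds wW.
move: (early w) b_le_k b_le_c => b b_le_k b_le_c b_ge S_small.
have B0 : 0 <= delta + S%:R + 1 by rewrite !addr_ge0.
have atom_sum : \sum_(j < b.+1) atom R W early j <= 1.
  by rewrite -cdf_sum; exact: prob_le1.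
have [->|S0] := posnP S.
  rewrite big_ord_recr /= in atom_sum.
  have sum0 : 0 <= \sum_(j < b) atom R W early j.
    by apply: sumr_ge0 => j _; exact: prob_ge0.
  have atom_ge0 : 0 <= atom R W early b by exact: prob_ge0.
  by lra.
have S1 : 1 <= S%:R :> R by rewrite ler1n.
have B_le : 16 * (delta + S%:R + 1) <= (c e)%:R.
  by apply: le_trans S_small; rewrite ler_peMr // mulr_ge0.
have c0 : 0 < (c e)%:R :> R by lra.
have Sb : (S <= b)%N by rewrite -(ler_nat R); lra.
apply: (slow_decay_le (t := 8 * (delta + S%:R + 1) / (c e)%:R)) => //.
- by move=> j; exact: prob_ge0.
- by rewrite divr_ge0 ?mulr_ge0.
- by rewrite mulrA ler_pdivrMr //; lra.
move=> j /andP[jS jb]; apply: early_atom_ratio.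
- exact: leq_trans jb b_le_k.
- exact: leq_trans jb b_le_c.
- by lra.
have : b%:R <= j%:R + S%:R :> R by rewrite -natrD ler_nat addnC -leq_subLR.
by rewrite -[j.+1%:R]natr1; lra.
Qed.

End EarlyLast.

Lemma delta_young_le (R : realType) n (lam : seq nat) (dev : R) (S : nat) :
  is_partition n lam -> (1 < size lam)%N -> 1 <= dev ->
  8 * moment_const R (size lam) * n%:R < dev ^+ 2 ->
  2 * dev < (nth 0%N lam (size lam).-1)%:R ->
  16 * (dev + S%:R + 1) * S%:R <= (nth 0%N lam (size lam).-1)%:R ->
  delta (young lam) R <= 4 / S.+1%:R.
Proof.
move=> lamP d1 dev1; have := partition_shape lamP.
set e := (size lam).-1; set c := nth 0%N lam => sc.
have e0 : (0 < e)%N by rewrite /e -subn1 subn_gt0.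
have de : size lam = e.+1 by rewrite prednK // ltnW.
move: (sc); rewrite de => sc' dev_big c_big S_small.
have n1 : (1 < n)%N.
  have : (c e)%:R <= n%:R :> R by rewrite ler_nat (leq_shape sc').
  by rewrite -(ltr_nat R); lra.
have [w wW med] :=
  lower_median_exists R (early_last e (half_stars e c)) (size_words_gt0 sc').
have b_ge := lower_median_early_ge sc' e0 n1 dev1 dev_big med.
have [b_le_k b_le_c] := early_bounds sc' e0 wW.
have := early_atom_le sc' e0 wW (le_trans ler01 dev1) b_ge S_small.
move: (early_last _ _ w) med b_ge b_le_k b_le_c =>
  [|b] med b_ge b_le_k b_le_c atom_le.
  by lra.
have k_le_c := half_stars_le_first sc'.
have a_lt : (half_stars e c - b.+1 < c 0)%N by lia.
have row0 : (0 < size lam)%N := ltnW d1.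
have rowe : (e < size lam)%N by rewrite de.
pose x : young lam := cell (i := Ordinal row0) (Ordinal a_lt).
pose y : young lam := cell (i := Ordinal rowe) (Ordinal b_le_c).
apply: le_trans (delta_le_first_row lamP R (x := x) (y := y) _ _) _ => //.
rewrite /young_row /young_col /= -addnS subnK // de.
apply: le_trans (lower_median_jump med) _.
by rewrite ler_pdivlMr ?ltr0n //; lra.
Qed.

Lemma delta_young_sqrt_le (R : realType) n (lam : seq nat) (eps K : R) :
  is_partition n lam -> (1 < size lam)%N -> 0 < eps ->
  eps * n%:R <= (nth 0%N lam (size lam).-1)%:R ->
  1 <= K -> 8 * moment_const R (size lam) < K ^+ 2 ->
  16 * (K + 2) / eps + 1 <= Num.sqrt n%:R ->
  delta (young lam) R <= 4 * (16 * (K + 2) / eps + 1) / Num.sqrt n%:R.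
Proof.
move=> lamP d1 eps0 last_ge K1 K_big; set r := Num.sqrt n%:R.
have r2 : r ^+ 2 = n%:R by rewrite sqr_sqrtr.
set D := 16 * (K + 2) / eps + 1 => Dr.
have D1 : 1 <= D by rewrite lerDr divr_ge0 ?ltW //; lra.
have Deps : D * eps = 16 * (K + 2) + eps.
  by rewrite mulrDl mul1r divfK // gt_eqF.
have D0 : 0 < D by lra.
have r0 : 0 < r by lra.
pose S := Num.truncn (r / D).
have S_le : S%:R * D <= r.
  by rewrite -ler_pdivlMr // truncn_le // divr_ge0 // ltW.
have S_gt : r <= S.+1%:R * D by rewrite -ler_pdivrMr // ltW // truncnS_gt.
have Sr : S%:R <= r by apply: le_trans S_le; rewrite ler_peMr.
have last_r : eps * r * r <= (nth 0%N lam (size lam).-1)%:R.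
  by rewrite -mulrA -expr2 r2.
have eps_r : 16 * (K + 2) + eps <= eps * r by rewrite -Deps mulrC ler_pM2l.
apply: (@le_trans _ _ (4 / S.+1%:R)); last first.
  by rewrite ler_pdivrMr ?ltr0n // mulrAC ler_pdivlMr //; lra.
apply: (delta_young_le (dev := K * r) lamP d1).
- by have := ler_pM ler01 ler01 K1 (le_trans D1 Dr); rewrite mulr1.
- by rewrite -r2 exprMn ltr_pM2r ?exprn_gt0.
- by have := ler_wpM2r (ltW r0) eps_r; have := mulr_gt0 eps0 r0; nra.
have S_eps : S%:R * (16 * (K + 2)) <= eps * r.
  have := ler_wpM2r (ltW eps0) S_le; rewrite -mulrA Deps.
  by have := mulr_ge0 (ler0n R S) (ltW eps0); lra.
have dev_le : K * r + S%:R + 1 <= (K + 2) * r by lra.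
have := ler_wpM2r (ltW r0) S_eps; have := ler_wpM2l (ler0n R S) dev_le.
by lra.
Qed.

Theorem theorem1p3 (R : realType) (d : nat) (eps : R) :
  (2 <= d)%N -> 0 < eps ->
  exists2 C : R, 0 < C &
    forall (n : nat) (lam : seq nat),
      is_partition n lam -> size lam = d ->
      eps * n%:R <= (nth 0%N lam d.-1)%:R ->
      delta (young lam) R <= C / Num.sqrt n%:R.
Proof.
move=> d2 eps0; have M0 := moment_const_gt0 R d.
pose K := 1 + 8 * moment_const R d; pose D := 16 * (K + 2) / eps + 1.
have K1 : 1 <= K by rewrite /K; lra.
have K_big : 8 * moment_const R d < K ^+ 2.
  by rewrite /K expr2; have := mulr_gt0 M0 M0; lra.
have D0 : 0 < D by rewrite ltr_wpDl // divr_ge0 ?ltW //; lra.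
exists (4 * D) => [|n lam lamP sz last_ge]; first by lra.
have [rD|Dr] := ltP (Num.sqrt n%:R) D; last first.
  by apply: delta_young_sqrt_le; rewrite // sz.
have r0 : 0 < Num.sqrt n%:R :> R.
  by rewrite sqrtr_gt0 ltr0n (partition_gt0 lamP) // sz ltnW.
by apply: le_trans (bigmin_le_id _ _ _ _) _; rewrite ler_pdivlMr //; lra.
Qed.
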